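(* Let $p$ be an odd prime, $n\ge 1$, and let $f(x)=\sum_{i=1}^k a_i x^{p^{\alpha_i}+1}\in\mathbb F_{p^n}[x]$ with $k\ge 1$, integers $0\le\alpha_1<\cdots<\alpha_k$, and $a_k\ne 0$. Assume $\nu_p(n)<\min\{\nu_p(\alpha_i):1\le i\le k\}$, and let $s$ be an integer with $0\le s\le\min\{\nu_p(\alpha_i):1\le i\le k\}-\nu_p(n)$. Then $$l_{p^sn}(f)=p^s\,l_n(f)\qquad\text{and}\qquad t_{p^sn}(f)=t_n(f).$$
   Context: $\nu_p$ is the $p$-adic order, with $\nu_p(0)=\infty$. Every quadratic form $F$ on an $N$-dimensional $\mathbb F_p$-vector space ($p$ odd) is, after a linear change of coordinates, equal to $x_1^2+\cdots+x_{r-1}^2+d x_r^2$ with $r\ge 0$ and $d\in\mathbb F_p^*$. The integer $r$ is the rank of $F$, $N-r$ is its nullity, and $\eta(d)\in\{\pm1\}$ is its type, where $\eta$ is the quadratic character of $\mathbb F_p$; if $F=0$ its type is defined to be $1$. For a positive integer $N$ divisible by $n$, $\mathrm{Tr}_N$ is the absolute trace $\mathbb F_{p^N}\to\mathbb F_p$; the map $x\mapsto \mathrm{Tr}_N(f(x))$ is a quadratic form on the $N$-dimensional $\mathbb F_p$-space $\mathbb F_{p^N}$, and $l_N(f)$, $t_N(f)$ denote its nullity and type. *)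

(* Defs.v *)
From HB Require Import structures.
From mathcomp Require Import all_boot all_order all_algebra all_fingroup.
From mathcomp Require Import all_field boolp constructive_ereal.

Set Implicit Arguments.
Unset Strict Implicit.
Unset Printing Implicit Defensive.

Import Order.TTheory GRing.Theory Num.Theory.
Local Open Scope ring_scope.

(* Unlike [logn p 0 = 0], this takes the value +oo at 0. *)
Definition padic_order (p m : nat) : \bar int :=
  if m == 0%N then +oo%E else ((logn p m)%:Z)%:E.

Definition quad_char (F : finFieldType) (d : F) : int :=
  if d == 0 then 0 else if [exists e : F, e ^+ 2 == d] then 1 else -1.

Section QuadraticForm.

Variables (F : finFieldType) (V : vectType F).
Implicit Types (Q : V -> F) (r : nat) (d : F).

(* In the coordinates x_1, ..., x_N attached to the basis b, Q is
   x_1^2 + ... + x_(r-1)^2 + d x_r^2 (which is 0 when r = 0). *)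
Definition diagonalized Q r d : Prop :=
  exists2 b : (\dim {:V}).-tuple V, basis_of {:V} b &
    forall v : V, Q v =
      \sum_(i < \dim {:V} | (i < r)%N)
        (if i.+1 == r then d else 1) * coord b i v ^+ 2.

(* For a quadratic form in odd characteristic such a pair (r, d) exists, r is
   unique, and d is unique up to nonzero squares when r > 0. *)
Definition diag_data Q : 'I_(\dim {:V}).+1 * F :=
  odflt (ord0, 1)
    [pick rd : 'I_(\dim {:V}).+1 * F |
      (rd.2 != 0) && `[< diagonalized Q rd.1 rd.2 >]].

Definition qrank Q : nat := (diag_data Q).1.

Definition nullity Q : nat := (\dim {:V} - qrank Q)%N.

Definition qtype Q : int :=
  if `[< forall v : V, Q v = 0 >] then 1 else quad_char (diag_data Q).2.

End QuadraticForm.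

Section TraceForm.

Variables (p : nat) (L : splittingFieldType 'F_p).

(* [galTrace 1 {:L} x] is an element of L lying in the prime subfield
   1 = <[1]>; its coordinate on the basis (1) is the corresponding element
   of 'F_p. Every finite extension of 'F_p is a splitting field. *)
Definition abs_trace (x : L) : 'F_p :=
  coord [tuple (1 : L)] ord0 (galTrace 1%VS {:L}%VS x).

Definition trace_form (f : {poly L}) (x : L) : 'F_p := abs_trace f.[x].

Definition l_ (f : {poly L}) : nat := nullity (trace_form f).

Definition t_ (f : {poly L}) : int := qtype (trace_form f).

End TraceForm.

(* Main.v *)
Require Import Defs.
From HB Require Import structures.
From mathcomp Require Import all_boot all_order all_algebra all_fingroup.
From mathcomp Require Import all_field boolp constructive_ereal.
From mathcomp Require Import all_solvable ring zify.

Set Implicit Arguments.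
Unset Strict Implicit.
Unset Printing Implicit Defensive.

Import Order.TTheory GRing.Theory Num.Theory.
Local Open Scope ring_scope.

(** Put m = p^s, let K and L be the fields with p^n and p^(m n) elements, and
    let C = p^(s + nu_p(n)), so that C divides m n and every alpha_i. The
    elements fixed by x |-> x^(p^C) form a subfield F of L with L = K F, and the
    maps x |-> x^(p^alpha_i) are F-linear. If e_1, ..., e_m in F are self-dual
    for the trace, Tr_{L/K}(e_i e_j) = [i = j], then L is the direct sum of the
    K e_j and Tr_L(f(sum_j x_j e_j)) = sum_j Tr_K(f(x_j)): the form on L is an
    orthogonal sum of m copies of the form on K. The nullity is thus multiplied
    by m, and the discriminant is raised to the m-th power, which does not
    change its class modulo squares because m is odd.

    Self-dual elements exist because the Gram matrix of 1, theta, ...,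
    theta^(m-1), for theta generating F, is M M^T with M the Vandermonde matrix
    of the conjugates of theta over K. It is diagonalized as (1, ..., 1, d) over
    k = F \cap K, where d is the square of some c in F; as F has odd degree m
    over k, c lies in k. *)

(** * Symmetric matrices over a finite field *)

Lemma pchar_odd_two_neq0 (R : nzRingType) p :
  p \in [pchar R] -> odd p -> 2%:R != 0 :> R.
Proof.
move=> pR p_odd; rewrite -(dvdn_pcharf pR) dvdn_prime2 ?(pcharf_prime pR) //.
by case: eqP p_odd => // ->.
Qed.

Section SymmetricMatrices.

Variable F : finFieldType.
Hypothesis two_neq0 : 2%:R != 0 :> F.

(* A, the chosen square roots, and -A cover F and share 0. *)
Lemma card_squares_gt : (#|F| < 2 * #|[set x ^+ 2 | x : F]|)%N.
Proof.
set S := [set x ^+ 2 | x : F].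
pose r y : F := odflt 0 [pick x | x ^+ 2 == y].
pose A := r @: S; pose B := -%R @: A.
have leA : (#|A| <= #|S|)%N by apply: leq_imset_card.
have leB : (#|B| <= #|S|)%N by apply: leq_trans leA; apply: leq_imset_card.
have AB : A :|: B = setT.
  apply/setP => x; rewrite !inE; apply/orP.
  have xS : x ^+ 2 \in S by apply: imset_f.
  have : r (x ^+ 2) ^+ 2 == x ^+ 2.
    by rewrite /r; case: pickP => [//|/(_ x)]; rewrite eqxx.
  rewrite eqf_sqr => /orP[] /eqP e; [left|right].
    by rewrite -e imset_f.
  by rewrite -[x]opprK -e !imset_f.
have r0 : r 0 = 0.
  by rewrite /r; case: pickP => [x /=|//]; rewrite expf_eq0 => /andP[_ /eqP].
have S0 : 0 \in S by apply/imsetP; exists 0; rewrite ?expr0n.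
have A0 : 0 \in A by rewrite -[X in X \in _]r0 imset_f.
have B0 : 0 \in B by rewrite -[X in X \in _]oppr0 imset_f.
have : (0 < #|A :&: B|)%N by rewrite card_gt0; apply/set0Pn; exists 0; rewrite inE A0.
move=> AB0; rewrite mul2n -addnn; apply: leq_trans (leq_add leA leB).
by rewrite -cardsUI AB cardsT -addn1 leq_add2l.
Qed.

(** The values of [a * x ^+ 2] and of [1 - b * y ^+ 2] each fill more than half of [F], so they
    meet. *)
Lemma two_squares (a b : F) : a != 0 -> b != 0 ->
  exists x y, a * x ^+ 2 + b * y ^+ 2 = 1.
Proof.
move=> a0 b0; set S := [set x ^+ 2 | x : F].
pose A := ( *%R a) @: S; pose B := (fun x => 1 - b * x) @: S.
have cA : #|A| = #|S| by rewrite card_imset //; apply: mulfI.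
have cB : #|B| = #|S|.
  by rewrite card_imset // => x y /addrI /oppr_inj; apply: mulfI.
have lt := card_squares_gt.
have : (0 < #|A :&: B|)%N.
  rewrite -(ltn_add2l #|A :|: B|) addn0 cardsUI cA cB addnn -mul2n.
  exact: leq_ltn_trans (max_card _) lt.
rewrite card_gt0 => /set0Pn[z]; rewrite inE => /andP[/imsetP[_ /imsetP[x _ ->] ->]].
by case/imsetP => _ /imsetP[y _ ->] e; exists x, y; rewrite e subrK.
Qed.

(** If the diagonal vanishes, the sum of two coordinate vectors has value [2 * G i j]. *)
Lemma sym_mx_anisotropic m (G : 'M[F]_m) : G^T = G -> G != 0 ->
  exists v : 'rV_m, (v *m G *m v^T) 0 0 != 0.
Proof.
move=> Gs Gn0.
have Gij i j :
    ((delta_mx 0 i : 'rV_m) *m G *m (delta_mx 0 j : 'rV_m)^T) 0 0 = G i j.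
  by rewrite trmx_delta -rowE -colE !mxE.
case: (pickP (fun i => G i i != 0)) => [i Gi | G0].
  by exists (delta_mx 0 i); rewrite Gij.
have {}G0 i : G i i = 0 by apply/eqP; move/negbFE: (G0 i).
case: (pickP (fun ij : 'I_m * 'I_m => G ij.1 ij.2 != 0)) => [[i j] /= Ge | G00].
  have addE (A B : 'M[F]_1) : (A + B) 0 0 = A 0 0 + B 0 0 by rewrite mxE.
  exists (delta_mx 0 i + delta_mx 0 j); rewrite mulmxDl linearD /= mulmxDr !mulmxDl.
  rewrite !addE !Gij !G0 add0r addr0 -{1}Gs mxE -mulr2n -mulr_natl.
  by rewrite mulf_neq0.
case/eqP: Gn0; apply/matrixP => i j; rewrite mxE; apply/eqP.
by move/negbFE: (G00 (i, j)).
Qed.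

(** Complete [v] to a basis, then clear the off-diagonal blocks by subtracting multiples of [v];
    [G'] is the Schur complement. *)
Lemma sym_mx_split m (G : 'M[F]_(1 + m)) (v : 'rV_(1 + m)) :
    G^T = G -> (v *m G *m v^T) 0 0 != 0 ->
  exists P (G' : 'M_m), [/\ P \in unitmx, G'^T = G' &
    P *m G *m P^T = block_mx (v *m G *m v^T) 0 0 G'].
Proof.
move=> Gs; set c := v *m G *m v^T => c0.
have v0 : v != 0 by apply: contraNneq c0 => v0; rewrite /c v0 !mul0mx mxE.
have rv : \rank v = 1%N by apply/eqP; rewrite eqn_leq rank_leq_row lt0n mxrank_eq0.
(* [v] is the scalar [col_ebase v] times the first row of [row_ebase v]; rescaling that row gives an
   invertible matrix with first row [v]. *)
pose E := block_mx (col_ebase v) 0 0 1%:M *m row_ebase v.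
have Eu : E \in unitmx.
  rewrite unitmx_mul row_ebase_unit andbT unitmxE det_ublock det1 mulr1 -unitmxE.
  exact: col_ebase_unit.
have vE : v = usubmx E.
  rewrite /E -[X in X *m _]/(col_mx (row_mx _ _) (row_mx _ _)) mul_col_mx col_mxKu.
  rewrite -{1}[v]mulmx_ebase rv; congr (_ *m _).
  have -> : pid_mx 1 = row_mx 1%:M 0 :> 'M[F]_(1, 1 + m).
    apply/matrixP => i j; rewrite !mxE ord1; case: splitP => k -> /=.
      by rewrite !mxE ord1 eqxx.
    by rewrite mxE.
  by rewrite mul_mx_row mulmx1 mulmx0.

clearbody E.
have G1s : (E *m G *m E^T)^T = E *m G *m E^T by rewrite !trmx_mul trmxK Gs mulmxA.
pose G1 := E *m G *m E^T; rewrite -/G1 in G1s.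
have cE : c = ulsubmx G1.
  by rewrite /c vE /G1 -{3 4}[E]vsubmxK tr_col_mx mul_col_mx mul_col_row block_mxKul.
have blk : G1 = block_mx c (ursubmx G1) (ursubmx G1)^T (drsubmx G1).
  by rewrite cE trmx_ursub G1s submxK.
set g := ursubmx G1 in blk; set H := drsubmx G1 in blk.
have Hs : H^T = H by rewrite /H trmx_drsub G1s.
have cs : c = (c 0 0)%:M by apply/mx11_scalar.
set t := c 0 0 in c0 cs; clearbody t.
pose U : 'M[F]_(1 + m) := block_mx 1%:M 0 (- (t)^-1 *: g^T) 1%:M.
exists (U *m E), (H - (t)^-1 *: (g^T *m g)); split.
- by rewrite unitmx_mul Eu andbT unitmxE det_lblock !det1 mulr1 unitr1.
- by rewrite linearB /= Hs linearZ /= trmx_mul trmxK.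
have -> : (U *m E) *m G *m (U *m E)^T = U *m G1 *m U^T by rewrite trmx_mul !mulmxA.
rewrite blk /U tr_block_mx !mulmx_block.
rewrite !trmx1 !trmx0 !mul1mx !mul0mx !mulmx1 !mulmx0 !addr0 ?add0r.
rewrite cs !linearZ /= trmxK -!scalemxAl mul_mx_scalar mul_scalar_mx.
rewrite !scalerA mulNr mulVf // !scaleN1r !addNr mul0mx scaler0 add0r.
by rewrite scaleNr scalerN addrC.
Qed.

Definition std_weight r (d : F) (i : nat) : F :=
  if (i < r)%N then if i.+1 == r then d else 1 else 0.

(** Induction on the size. When the rank exceeds one, [two_squares] yields a vector of value 1 to
    split off, so the arbitrary weight [d] is pushed to the last nonzero position. *)
Lemma sym_mx_diag m (G : 'M[F]_m) : G^T = G ->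
  exists P r d, [/\ P \in unitmx, (r <= m)%N, d != 0 &
    P *m G *m P^T = diag_mx (\row_i std_weight r d i)].
Proof.
elim: m G => [|m IH] G Gs.
  exists 1%:M, 0, 1; split; rewrite ?unitmx1 ?oner_eq0 //.
  by apply/matrixP => -[].
case: (eqVneq G 0) => [->|G0].
  exists 1%:M, 0, 1; split; rewrite ?unitmx1 ?oner_eq0 // mulmx0 mul0mx.
  by apply/matrixP => i j; rewrite !mxE mul0rn.
have [v vG] := sym_mx_anisotropic Gs G0.
have [P1 [G1 [P1u G1s e1]]] := sym_mx_split Gs vG.
(* Prepending [c] keeps the standard shape if [c] is 1 or if the remaining rank is 0, in which case
   [c] becomes the new [d]. *)
have aux (P2 : 'M_(1 + m)) (c : F) r d : P2 \in unitmx ->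
    P2 *m G *m P2^T = block_mx c%:M 0 0 (diag_mx (\row_i std_weight r d i)) ->
    (r <= m)%N -> d != 0 -> c != 0 -> (r == 0%N) || (c == 1) ->
  exists P r d, [/\ P \in unitmx, (r <= m.+1)%N, d != 0 &
    P *m G *m P^T = diag_mx (\row_i std_weight r d i)].
  move=> P2u e2 rm d0 c0 rc.
  exists P2, r.+1, (if r == 0%N then c else d); split => //; first by case: ifP.
  have W : \row_(i < 1 + m) std_weight r.+1 (if r == 0%N then c else d) i
    = row_mx c%:M (\row_(i < m) std_weight r d i).
    apply/rowP => i; rewrite !mxE; case: splitP => k ek.
      rewrite ord1 in ek; rewrite ek ord1 mxE eqxx mulr1n /std_weight /= eqSS eq_sym.
      by case: eqP rc => //= _ /eqP.
    rewrite mxE ek add1n /std_weight ltnS eqSS; case: ltnP => // kr.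
    by case: (r =P 0%N) kr => [->|].
  apply: (etrans e2); have := congr1 (@diag_mx F (1 + m)) W.
  rewrite diag_mx_row => ->; congr block_mx.
  by apply/matrixP => i j; rewrite !ord1 !mxE eqxx.
case: (eqVneq G1 0) => [G10|G10].
  apply: (aux P1 ((v *m G *m v^T) 0 0) 0%N 1) => //; rewrite ?oner_eq0 //.
  rewrite e1 -mx11_scalar G10; congr block_mx.
  by apply/matrixP => i j; rewrite !mxE mul0rn.
have [w wG] := sym_mx_anisotropic G1s G10.
have [x [y]] := two_squares vG wG.
move: (mx11_scalar (v *m G *m v^T)) (mx11_scalar (w *m G1 *m w^T)).
set c := (v *m G *m v^T) 0 0; set c' := (w *m G1 *m w^T) 0 0 => ec ec' exy.
(* In the basis given by [P1], [w] is orthogonal to the first vector, so [v2] has value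
   [c * x ^+ 2 + c' * y ^+ 2], which is 1. *)
set v2 := row_mx x%:M (y *: w) *m P1.
have e2 : v2 *m G *m v2^T = 1%:M.
  rewrite /v2 trmx_mul tr_row_mx mulmxA -(mulmxA _ P1) -(mulmxA _ _ P1^T) e1.
  rewrite mul_row_block mul_row_col !mulmx0 addr0 add0r.
  rewrite linearZ /= -!scalemxAl -!scalemxAr scalerA tr_scalar_mx.
  rewrite mul_scalar_mx mul_mx_scalar scalerA.
  rewrite ec ec' !scale_scalar_mx -raddfD /=; congr _%:M.
  by rewrite -exy; ring.
have v2G : (v2 *m G *m v2^T) 0 0 != 0 by rewrite e2 mxE oner_eq0.
have [P2 [G2 [P2u G2s]]] := sym_mx_split Gs v2G; rewrite e2 => {}e2.
have [P3 [r [d [P3u rm d0 e3]]]] := IH _ G2s.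
apply: (aux (block_mx 1%:M 0 0 P3 *m P2) 1 r d) => //; rewrite ?oner_eq0 ?eqxx ?orbT //.
  by rewrite unitmx_mul P2u andbT unitmxE det_ublock det1 mul1r -unitmxE.
rewrite trmx_mul mulmxA -(mulmxA _ P2) -(mulmxA _ _ P2^T) e2 tr_block_mx !mulmx_block.
by rewrite !trmx0 trmx1 !(mulmx0, mul0mx, mulmx1, mul1mx, addr0, add0r) e3.
Qed.

End SymmetricMatrices.

(** * Rank and type of a diagonal form *)

Section QuadChar.

Variable F : finFieldType.

Lemma quad_charMsq (x d : F) : x != 0 -> quad_char (x ^+ 2 * d) = quad_char d.
Proof.
move=> x0; rewrite /quad_char mulf_eq0 expf_eq0 /= (negPf x0) /=.
case: eqP => // _; congr (if _ then _ else _); apply/existsP/existsP => -[e /eqP ee].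
  by exists (e / x); rewrite expr_div_n ee mulrAC mulfV ?expf_neq0 // mul1r.
by exists (x * e); rewrite exprMn ee.
Qed.

Lemma quad_charX (d : F) m : d != 0 -> odd m -> quad_char (d ^+ m) = quad_char d.
Proof.
move=> d0 om; rewrite -(odd_double_half m) om exprS -mul2n mulnC exprM mulrC.
by rewrite quad_charMsq // expf_neq0.
Qed.

End QuadChar.

Section DiagonalForms.

Variables (F : finFieldType) (V : vectType F).
Hypothesis two_neq0 : 2%:R != 0 :> F.
Local Notation N := (\dim {:V}).
Implicit Types (Q : V -> F) (b : N.-tuple V) (w : nat -> F).

(** Weights form a sequence on [nat], so that they can be truncated at the rank or reindexed by
    [q %/ m]. *)
Definition diag_in b w Q : Prop :=
  forall v, Q v = \sum_(i < N) w i * coord b i v ^+ 2.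

Lemma diag_in_polar b w Q u v : diag_in b w Q ->
  Q (u + v) - Q u - Q v = 2%:R * \sum_(i < N) w i * (coord b i u * coord b i v).
Proof.
move=> Qw; rewrite !Qw -!sumrB mulr_sumr; apply: eq_bigr => i _.
by rewrite linearD /=; ring.
Qed.

(** Both sides are half the polar form of [Q] at two vectors of [b], computed in the two systems of
    coordinates. *)
Lemma diag_in_gram b b' w w' Q (i k : 'I_N) :
    basis_of {:V} b -> diag_in b w Q -> diag_in b' w' Q ->
  w i *+ (i == k) = \sum_(j < N) w' j * (coord b' j b`_i * coord b' j b`_k).
Proof.
move=> bb Qw Qw'; apply: (mulfI two_neq0).
rewrite -(diag_in_polar _ _ Qw') (diag_in_polar _ _ Qw) (bigD1 i) //= big1 => [|j ji].
  rewrite !coord_free ?(basis_free bb) // eqxx mul1r addr0.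
  by rewrite [k == i]eq_sym [in RHS]mulr_natr.
by rewrite coord_free ?(basis_free bb) // eq_sym (negPf ji) mul0r mulr0.
Qed.

(* Compares the determinants of the upper left r x r blocks of the two Gram matrices. *)
Lemma diag_in_inertia_le b b' w w' r r' Q :
    basis_of {:V} b -> diag_in b w Q -> diag_in b' w' Q ->
    (r' <= r <= N)%N -> (forall i, (i < r)%N -> w i != 0) ->
    (forall i, (r' <= i < N)%N -> w' i = 0) ->
  r = r' /\ exists2 x, x != 0 &
    \prod_(i < r) w i = x ^+ 2 * \prod_(i < r) w' i.
Proof.
move=> bb Qw Qw' /andP[r'r rN] w0 w'0.
pose A := \matrix_(i < r, j < r) coord b' (widen_ord rN j) b`_i.
have e : diag_mx (\row_(i < r) w i) = A *m diag_mx (\row_(i < r) w' i) *m A^T.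
  apply/matrixP => i k; rewrite mul_mx_diag !mxE.
  have := diag_in_gram (widen_ord rN i) (widen_ord rN k) bb Qw Qw'.
  rewrite -val_eqE /= => ->.
  rewrite (bigID (fun j : 'I_N => (j < r)%N)) /= [X in _ + X]big1 => [|j]; last first.
    rewrite -leqNgt => rj; rewrite w'0 ?mul0r // ltn_ord andbT.
    exact: leq_trans rj.
  rewrite addr0 (big_ord_narrow rN) /=; apply: eq_bigr => j _.
  by rewrite !mxE; ring.
have /(congr1 determinant) := e.
rewrite !det_mulmx det_tr !det_diag mulrAC -expr2.
under eq_bigr do rewrite mxE.
under [in RHS]eq_bigr do rewrite mxE.
move=> ed; have /prodf_neq0 p0 : \prod_(i < r) w i != 0.
  by apply/prodf_neq0 => i _; apply: w0.
have : \prod_(i < r) w i != 0 by apply/prodf_neq0 => i _; apply: w0.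
rewrite ed mulf_eq0 expf_eq0 /= negb_or => /andP[detA /prodf_neq0 w'n0].
split; last by exists (\det A).
apply/eqP; rewrite eqn_leq r'r andbT leqNgt; apply/negP => lt.
by have := w'n0 (Ordinal lt) isT; rewrite w'0 ?eqxx //= leqnn (leq_trans lt).
Qed.

Lemma diag_in_inertia b b' w w' r r' Q :
    basis_of {:V} b -> basis_of {:V} b' -> diag_in b w Q -> diag_in b' w' Q ->
    (r <= N)%N -> (r' <= N)%N ->
    (forall i, (i < N)%N -> (w i != 0) = (i < r)%N) ->
    (forall i, (i < N)%N -> (w' i != 0) = (i < r')%N) ->
  r = r' /\ exists2 x, x != 0 &
    \prod_(i < r) w i = x ^+ 2 * \prod_(i < r') w' i.
Proof.
move=> bb bb' Qw Qw' rN r'N w0 w'0.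
have W (u : nat -> F) q : (q <= N)%N -> (forall i, (i < N)%N -> (u i != 0) = (i < q)%N) ->
    (forall i, (i < q)%N -> u i != 0) /\ (forall i, (q <= i < N)%N -> u i = 0).
  move=> qN u0; split=> i; first by move=> iq; rewrite u0 // (leq_trans iq).
  by case/andP=> qi iN; apply/eqP; rewrite -[_ == _]negbK u0 // -leqNgt.
have [w1 w2] := W w r rN w0; have [w1' w2'] := W w' r' r'N w'0.
case/orP: (leq_total r' r) => le.
  by have [|<- e] := diag_in_inertia_le bb Qw Qw' _ w1 w2'; first by rewrite le.
have [|<- [x x0 e]] := diag_in_inertia_le bb' Qw' Qw _ w1' w2; first by rewrite le.
split=> //; exists x^-1; rewrite ?invr_eq0 // e exprVn mulrA mulVf ?mul1r //.
by rewrite expf_neq0.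
Qed.

Lemma std_weight_neq0 r (d : F) i : d != 0 -> (std_weight r d i != 0) = (i < r)%N.
Proof.
rewrite /std_weight => d0; case: ifP; rewrite ?eqxx //.
by case: ifP; rewrite ?d0 ?oner_eq0.
Qed.

Lemma diagonalizedP Q r d :
  diagonalized Q r d <->
  exists2 b : N.-tuple V, basis_of {:V} b & diag_in b (std_weight r d) Q.
Proof.
have e (b : N.-tuple V) v :
    \sum_(i < N | (i < r)%N) (if i.+1 == r then d else 1) * coord b i v ^+ 2
    = \sum_(i < N) std_weight r d i * coord b i v ^+ 2.
  rewrite big_mkcond; apply: eq_bigr => i _; rewrite /std_weight.
  by case: ifP; rewrite ?mul0r.
by split=> -[b bb Qb]; exists b => // v; rewrite Qb e.
Qed.

(** The rows of [P] are the coordinates in [b] of the new basis, so a row [x] of old coordinates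
    becomes [x *m invmx P]. *)
Lemma gram_diagonalized Q b (G : 'M[F]_N) : basis_of {:V} b -> G^T = G ->
    (forall v, Q v = \sum_(i < N) \sum_(j < N) G i j * (coord b i v * coord b j v)) ->
  exists r d, [/\ (r <= N)%N, d != 0 & diagonalized Q r d].
Proof.
move=> bb Gs QG; have [P [r [d [Pu rN d0 e]]]] := sym_mx_diag two_neq0 Gs.
exists r, d; split=> //; apply/diagonalizedP.
pose c := [tuple \sum_(i < N) P k i *: b`_i | k < N].
have cE (k : 'I_N) : c`_k = \sum_(i < N) P k i *: b`_i by rewrite -tnth_nth tnth_mktuple.
have comb (y : 'rV_N) : \sum_(k < N) y 0 k *: c`_k = \sum_(i < N) (y *m P) 0 i *: b`_i.
  under eq_bigr do rewrite cE scaler_sumr.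
  rewrite exchange_big; apply: eq_bigr => i _; rewrite mxE scaler_suml.
  by apply: eq_bigr => k _; rewrite scalerA.
have cf : free c.
  apply/freeP => k k0 i; have := comb (\row_i k i).
  under eq_bigr do rewrite mxE.
  have/freeP fb := basis_free bb; rewrite k0 => /esym/fb z.
  have : (\row_i k i) *m P = 0 by apply/rowP => j; rewrite z mxE.
  move/(congr1 (mulmx^~ (invmx P))); rewrite mulmxK // mul0mx => /rowP/(_ i).
  by rewrite !mxE.
have bc : basis_of {:V} c by rewrite basisEfree cf subvf size_tuple leqnn.
exists c => // v.
pose x := \row_i coord b i v; pose y := x *m invmx P.
have xy : y *m P = x by rewrite mulmxKV.
have vy : v = \sum_(k < N) y 0 k *: c`_k.
  rewrite comb xy {1}(coord_basis bb (memvf v)).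
  by apply: eq_bigr => i _; rewrite mxE.
have -> : Q v = (x *m G *m x^T) 0 0.
  rewrite QG exchange_big mxE; apply: eq_bigr => j _; rewrite !mxE mulr_suml.
  by apply: eq_bigr => i _; rewrite !mxE; ring.
rewrite -xy trmx_mul mulmxA -(mulmxA y) -(mulmxA y) e mul_mx_diag mxE.
apply: eq_bigr => k _; rewrite {1}vy coord_sum_free // !mxE; ring.
Qed.

(** [B] may fail to be symmetric; its symmetrization, halved, defines the same [Q]. *)
Lemma bilinear_diagonalized Q (B : V -> V -> F) :
    (forall c x x' y, B (c *: x + x') y = c * B x y + B x' y) ->
    (forall c x y y', B x (c *: y + y') = c * B x y + B x y') ->
    (forall v, Q v = B v v) ->
  exists r d, [/\ (r <= N)%N, d != 0 & diagonalized Q r d].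
Proof.
move=> Bl Br QB; pose b := vbasis {:V}.
have B0l y : B 0 y = 0.
  by have := Bl (-1) 0 0 y; rewrite scaler0 addr0 mulN1r addNr.
have B0r x : B x 0 = 0.
  by have := Br (-1) x 0 0; rewrite scaler0 addr0 mulN1r addNr.
have sl (c : 'I_N -> F) y : B (\sum_i c i *: b`_i) y = \sum_i c i * B b`_i y.
  by elim/big_rec2: _ => [|i u v _ <-]; rewrite ?B0l ?Bl.
have sr (c : 'I_N -> F) x : B x (\sum_i c i *: b`_i) = \sum_i c i * B x b`_i.
  by elim/big_rec2: _ => [|i u v _ <-]; rewrite ?B0r ?Br.
pose G := \matrix_(i < N, j < N) (2%:R^-1 * (B b`_i b`_j + B b`_j b`_i)).
apply: (gram_diagonalized (G := G) (vbasisP {:V})).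
  by apply/matrixP => i j; rewrite !mxE addrC.
move=> v; apply: (mulfI two_neq0).
have QE : Q v = \sum_(i < N) \sum_(j < N) coord b i v * coord b j v * B b`_i b`_j.
  rewrite QB {1 2}(coord_basis (vbasisP _) (memvf v)) sl; apply: eq_bigr => i _.
  by rewrite sr mulr_sumr; apply: eq_bigr => j _; rewrite mulrA.
rewrite [LHS]mulr_natl mulr2n {1}QE QE [X in _ + X]exchange_big -big_split mulr_sumr.
apply: eq_bigr => i _; rewrite -big_split mulr_sumr; apply: eq_bigr => j _ /=.
by rewrite mxE; field.
Qed.

Lemma diag_in_diagonalized b w Q : basis_of {:V} b -> diag_in b w Q ->
  exists r d, [/\ (r <= N)%N, d != 0 & diagonalized Q r d].
Proof.
move=> bb Qw; apply: (gram_diagonalized (G := diag_mx (\row_i w i)) bb).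
  by rewrite tr_diag_mx.
move=> v; rewrite Qw; apply: eq_bigr => i _; rewrite (bigD1 i) //= big1 => [|j ji].
  by rewrite !mxE eqxx addr0 expr2.
by rewrite !mxE eq_sym (negPf ji) mul0r.
Qed.

(** [diag_data] picks an arbitrary normal form; by inertia, rank and type can be read off any
    diagonalization whose nonzero weights come first. *)
Lemma diag_in_invariants b w r Q :
    basis_of {:V} b -> diag_in b w Q -> (r <= N)%N ->
    (forall i, (i < N)%N -> (w i != 0) = (i < r)%N) ->
  qrank Q = r /\ qtype Q = quad_char (\prod_(i < r) w i).
Proof.
move=> bb Qw rN w0; rewrite /qtype /qrank /diag_data.
case: pickP => [[R d] /= /andP[d0 /asboolP/diagonalizedP[c bc Qd]] | none]; last first.
  (* A normal form exists, so the default value in [diag_data] is never reached. *)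
  have [R [d [RN d0 Qd]]] := diag_in_diagonalized bb Qw.
  have := none (inord R, d); rewrite /= inordK ?ltnS // d0 /= => /negbT.
  by move/asboolP; case.
have RN : (R <= N)%N by rewrite -ltnS.
have [rR [x x0 ->]] := diag_in_inertia bb bc Qw Qd rN RN w0
  (fun i _ => std_weight_neq0 R i d0).
split=> //; rewrite quad_charMsq //; case: asboolP => [Q0 | nQ0].
  (* A zero form has no nonzero weight, and its conventional type 1 is the character of the empty
     product. *)
  have -> : val R = 0%N.
    apply: (etrans (esym rR)); apply/eqP; rewrite -leqn0 leqNgt; apply/negP => r0.
    have N0 : (0 < N)%N := leq_trans r0 rN.
    have := w0 0%N N0; rewrite r0; move/negP; apply; apply/eqP.
    have := diag_in_gram (Ordinal N0) (Ordinal N0) bb Qw Qd.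
    have := diag_in_polar b`_0 b`_0 Qd; rewrite !Q0 !subr0 => /esym/eqP.
    rewrite mulf_eq0 (negPf two_neq0) /= => /eqP e0 e1.
    by rewrite -[w 0%N]mulr1n e1 e0.
  rewrite big_ord0 /quad_char oner_eq0; case: existsP => // -[].
  by exists 1; rewrite expr1n.
case: (posnP R) => [R0 | Rpos].
  by case: nQ0 => v; rewrite Qd big1 // => i _; rewrite /std_weight R0 mul0r.
case: R Rpos {RN Qd rR} => -[//|R] RN _ /=; congr quad_char.
rewrite big_ord_recr /= {2}/std_weight ltnSn eqxx big1 ?mul1r // => i _.
by rewrite /std_weight /= (leqW (ltn_ord i)) eqSS ltn_eqF ?ltn_ord.
Qed.

End DiagonalForms.

(** * Self-dual systems for the trace *)

Section FrobeniusPowers.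

Variables (p : nat) (L : splittingFieldType 'F_p).
Hypothesis p_pr : prime p.
Local Notation N := (\dim {:L}).

Lemma pchar_ext : p \in [pchar L].
Proof. by rewrite pchar_lalg pchar_Fp. Qed.

(** As a ring morphism, the power map is additive, injective and compatible with determinants. *)
Lemma frob_rmorphism k : {f : {rmorphism L -> L} | forall x, f x = x ^+ (p ^ k)}.
Proof.
elim: k => [|k [f fE]]; first by exists idfun => x; rewrite expn0 expr1.
exists (pFrobenius_aut pchar_ext \o f : {rmorphism L -> L}) => x /=.
by rewrite pFrobenius_autE fE -exprM -expnSr.
Qed.

Lemma frobD k (x y : L) : (x + y) ^+ (p ^ k) = x ^+ (p ^ k) + y ^+ (p ^ k).
Proof. by have [f fE] := frob_rmorphism k; rewrite -!fE rmorphD. Qed.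

Lemma frob_sum k (I : Type) (r : seq I) (P : pred I) (E : I -> L) :
  (\sum_(i <- r | P i) E i) ^+ (p ^ k) = \sum_(i <- r | P i) E i ^+ (p ^ k).
Proof.
have [f fE] := frob_rmorphism k; rewrite -fE rmorph_sum.
by apply: eq_bigr => i _; rewrite fE.
Qed.

Lemma frob_inj k : injective (fun x : L => x ^+ (p ^ k)).
Proof.
have [f fE] := frob_rmorphism k => x y; rewrite -!fE; exact: fmorph_inj.
Qed.

Lemma Fp_expX (a : 'F_p) k : a ^+ (p ^ k) = a.
Proof.
elim: k => [|k IH]; rewrite ?expr1 // expnSr exprM IH.
by have := expf_card a; rewrite card_Fp.
Qed.

Lemma frobZ k a (x : L) : (a *: x) ^+ (p ^ k) = a *: x ^+ (p ^ k).
Proof. by rewrite exprZn Fp_expX. Qed.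

Lemma frob_dim (x : L) : x ^+ (p ^ N) = x.
Proof.
by have := memvf x; rewrite Fermat's_little_theorem card_Fp // => /eqP.
Qed.

Lemma frob_fix_mul (x : L) c k : x ^+ (p ^ c) = x -> x ^+ (p ^ (c * k)) = x.
Proof.
by move=> xc; elim: k => [|k IH]; rewrite ?muln0 ?expr1 // mulnS expnD exprM xc.
Qed.

Lemma frob_gal : {sigma : gal_of {:L} | generator 'Gal({:L} / 1) sigma &
  forall k x, (sigma ^+ k)%g x = x ^+ (p ^ k)}.
Proof.
have [sigma gen sE] := finField_galois_generator (sub1v {:L}%AS).
exists sigma => // k x; elim: k => [|k IH]; first by rewrite gal_id expr1.
rewrite expgSr galM ?memvf // IH sE ?memvf // card_Fp // dimv1 expn1.
by rewrite -exprM -expnSr.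
Qed.

(** The Galois group is cyclic of order [N], so the powers [sigma ^+ i] with [i < N] list it without
    repetition. *)
Lemma galTrace_frob (x : L) : galTrace 1 {:L} x = \sum_(i < N) x ^+ (p ^ i).
Proof.
have [sigma /eqP gen sE] := frob_gal; rewrite /galTrace gen.
have oN : #[sigma]%g = N.
  rewrite orderE -gen -(galois_dim (finField_galois (sub1v {:L}%AS))).
  by rewrite dimv1 divn1.
have -> : <[sigma]>%g = [set (sigma ^+ (i : 'I_N))%g | i : 'I_N].
  apply/setP => t; apply/cycleP/imsetP => [[i ->]|[i _ ->]]; last by exists i.
  have iN : (i %% N < N)%N by rewrite ltn_mod -oN order_gt0.
  by exists (Ordinal iN) => //=; rewrite -oN -expg_mod_order.
rewrite big_imset /= => [|i j _ _ /eqP]; first by apply: eq_bigr => i _; apply: sE.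
by rewrite eq_expg_mod_order oN !modn_small ?ltn_ord // => /eqP/val_inj.
Qed.

(** The trace lies on the line spanned by 1 and is recovered from its coordinate; trace identities
    can thus be checked in [L]. *)
Lemma abs_traceE (x : L) : (abs_trace x)%:A = \sum_(i < N) x ^+ (p ^ i).
Proof.
rewrite -galTrace_frob /abs_trace; set t := galTrace _ _ x.
have : t \in 1%VS by apply: mem_galTrace (finField_galois (sub1v _)) (memvf _).
rewrite -span_seq1 => t1.
by rewrite [in RHS](coord_span (X := [tuple 1 : L]) t1) big_ord_recl big_ord0 addr0.
Qed.

Lemma scalar1_inj : injective (fun a : 'F_p => a%:A : L).
Proof.
move=> a b /eqP; rewrite -subr_eq0 -scalerBl scaler_eq0 oner_eq0 orbF subr_eq0.
by move/eqP.
Qed.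

Lemma abs_traceD (x y : L) : abs_trace (x + y) = abs_trace x + abs_trace y.
Proof.
apply: scalar1_inj; rewrite /= scalerDl !abs_traceE -big_split.
by apply: eq_bigr => i _; rewrite /= frobD.
Qed.

Lemma abs_traceZ a (x : L) : abs_trace (a *: x) = a * abs_trace x.
Proof.
apply: scalar1_inj; rewrite /= -scalerA !abs_traceE scaler_sumr.
by apply: eq_bigr => i _; rewrite frobZ.
Qed.

(** [theta] is a power, of order [p ^ C - 1], of a generator of the multiplicative group of [L]. *)
Lemma exists_frob_generator C : (0 < C)%N -> (C %| N)%N ->
  exists2 theta : L, theta ^+ (p ^ C) = theta &
    forall k, theta ^+ (p ^ k) = theta -> (C %| k)%N.
Proof.
move=> C0 CN; pose finL : finFieldType := finvect_type L.
have p1 : (1 < p)%N := prime_gt1 p_pr.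
have cL : #|finL| = (p ^ N)%N.
  by rewrite -(card_vspacef (Vector.class (finvect_type L))) card_vspace card_Fp.
have N0 : (0 < N)%N by exact: (adim_gt0 {:L}%AS).
have pX k : (0 < k)%N -> (0 < (p ^ k).-1)%N.
  by move=> k0; rewrite -subn1 subn_gt0 -(exp1n k) ltn_exp2r.
have /hasP[g _ gP] : has ((p ^ N).-1.-primitive_root) [seq x <- enum finL | x != 0].
  apply: has_prim_root => //; [exact: pX | | exact/filter_uniq/enum_uniq | ].
    apply/allP => x; rewrite mem_filter => /andP[x0 _]; rewrite unity_rootE.
    by rewrite -(inj_eq (mulfI x0)) -exprS prednK ?expn_gt0 ?(ltnW p1) // frob_dim mulr1.
  rewrite -(card_uniqP (filter_uniq _ (enum_uniq finL))) -cL -(cardC1 (0 : finL)).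
  by apply/eq_leq/eq_card => x; rewrite mem_filter mem_enum !inE andbT.
have dvd : ((p ^ C).-1 %| (p ^ N).-1)%N.
  by case/dvdnP: CN => q ->; rewrite mulnC expnM; apply: dvdn_pred_predX.
have := dvdn_prim_root gP dvd; set theta := g ^+ _ => thP.
have thE k : (theta ^+ (p ^ k) == theta) = ((p ^ C).-1 %| (p ^ k).-1)%N.
  have th0 : theta != 0.
    apply/eqP => th0; have /eqP := prim_expr_order thP.
    by rewrite th0 expr0n gtn_eqF ?pX // eq_sym oner_eq0.
  rewrite (prim_order_dvd thP) -[RHS](inj_eq (mulfI th0)) -exprS mulr1.
  by rewrite prednK ?expn_gt0 ?(ltnW p1).
have thC : theta ^+ (p ^ C) = theta by apply/eqP; rewrite thE.
exists theta => // k.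
(* With [u = k %% C], the relation becomes [p ^ C - 1] divides [p ^ u - 1]; the latter is smaller,
   so [u = 0]. *)
rewrite {1}(divn_eq k C) addnC mulnC expnD [(_ ^ _ * _)%N]mulnC exprM.
rewrite frob_fix_mul // => /eqP; rewrite thE; move: (ltn_pmod k C0).
rewrite /dvdn; case: (posnP (k %% C)) => [-> //|u0 uC /dvdn_leq] /(_ (pX _ u0)).
by rewrite leqNgt ltn_predRL prednK ?expn_gt0 ?(ltnW p1) // ltn_exp2l // uC.
Qed.

(** The power [p ^ n] shifts the terms cyclically, since the power [p ^ N] is the identity. *)
Lemma frob_trace_fix n m (x : L) : N = (m * n)%N ->
  (\sum_(k < m) x ^+ (p ^ (n * k))) ^+ (p ^ n) = \sum_(k < m) x ^+ (p ^ (n * k)).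
Proof.
move=> NE; rewrite frob_sum; under eq_bigr do rewrite -exprM -expnD -mulnSr.
case: m NE => [|m] NE; first by rewrite !big_ord0.
rewrite big_ord_recr big_ord_recl /= addrC; congr (_ + _).
by rewrite mulnC -NE frob_dim muln0.
Qed.

(* The sums below are the traces from L down to its subfield of p^n elements. *)
Lemma self_dual_system n m C : odd p -> N = (m * n)%N -> odd m -> (0 < C)%N ->
    (C %| N)%N -> (forall j, (0 < j < m)%N -> ~~ (C %| n * j)%N) ->
  exists e : 'I_m -> L, (forall i, e i ^+ (p ^ C) = e i) /\
    forall i j, \sum_(k < m) (e i * e j) ^+ (p ^ (n * k)) = (i == j)%:R.
Proof.
move=> p_odd NE m_odd C0 CN Cj.
have [theta thC thk] := exists_frob_generator C0 CN.
have two0 := pchar_odd_two_neq0 pchar_ext p_odd.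
have [sigma _ sE] := frob_gal.
(* The elements fixed by both powers [p ^ n] and [p ^ C]; the Gram matrix is diagonalized over this
   field. *)
pose k0 := fixedField_aspace [set (sigma ^+ n)%g; (sigma ^+ C)%g].
have k0P x : reflect (x ^+ (p ^ n) = x /\ x ^+ (p ^ C) = x) (x \in k0).
  apply: (iffP (fixedFieldP (memvf x))) => [h | [hn hC] t].
    by rewrite -!sE; split; apply: h; rewrite !inE eqxx ?orbT.
  by rewrite !inE => /orP[] /eqP ->; rewrite sE.
pose M : 'M[L]_m := Vandermonde m (\row_k theta ^+ (p ^ (n * k))).
have ME i k : M i k = (theta ^+ i) ^+ (p ^ (n * k)).
  by rewrite !mxE -!exprM mulnC.
(* Two equal nodes would give [C %| n * (j - i)], against the hypothesis on [C]. *)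
have detM : \det M != 0.
  rewrite det_Vandermonde; apply/prodf_neq0 => i _; apply/prodf_neq0 => j ij.
  rewrite !mxE subr_eq0; apply/eqP => e.
  have ji : (0 < j - i < m)%N by rewrite subn_gt0 ij (leq_ltn_trans (leq_subr _ _)).
  apply: (negP (Cj _ ji)); apply: thk; apply: (@frob_inj (n * i)).
  by rewrite /= -exprM -expnD -mulnDr subnK ?(ltnW ij) // e.
pose G := M *m M^T.
have Gs : G^T = G by rewrite trmx_mul trmxK.
(* The entries are traces of powers of [theta]: the power [p ^ n] fixes traces, and [p ^ C] fixes
   [theta]. *)
have Gk0 i j : G i j \in k0.
  have GE : G i j = \sum_(k < m) (theta ^+ (i + j)) ^+ (p ^ (n * k)).
    rewrite mxE; apply: eq_bigr => k _.
    by rewrite [M^T _ _]mxE !ME -exprMn -exprD.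
  apply/k0P; split; rewrite GE ?frob_trace_fix // frob_sum.
  by apply: eq_bigr => k _; rewrite exprAC [X in X ^+ _]exprAC thC.
pose kf : finFieldType := finvect_type (subvs_of k0).
pose v : {rmorphism kf -> L} := (vsval : {rmorphism subvs_of k0 -> L}).
have vk0 (x : kf) : v x \in k0 by apply: subvsP.
have two0k : 2%:R != 0 :> kf by rewrite -(fmorph_eq0 v) rmorph_nat.
pose G0 : 'M[kf]_m := \matrix_(i, j) vsproj k0 (G i j).
have vG0 : map_mx v G0 = G.
  by apply/matrixP => i j; rewrite mxE [G0 _ _]mxE; apply: vsprojK.
have G0s : G0^T = G0.
  by apply: (@map_mx_inj _ _ v); rewrite -map_trmx vG0.
have [P0 [r [d0 [P0u rm d00 eP]]]] := sym_mx_diag two0k G0s.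
pose P := map_mx v P0; pose d := v d0.
have dE : P *m G *m P^T = diag_mx (\row_i v (std_weight r d0 i)).
  rewrite -vG0 map_trmx -!map_mxM eP map_diag_mx; congr diag_mx.
  by apply/rowP => i; rewrite !mxE.
have detP : \det P != 0 by rewrite det_map_mx fmorph_eq0 -unitfE -unitmxE.
have detE : (\det P * \det M) ^+ 2 = \prod_(i < m) v (std_weight r d0 i).
  have := congr1 determinant dE; rewrite !det_mulmx !det_tr det_diag.
  by under eq_bigr do rewrite mxE; move=> <-; ring.
(* [c] is a square root of the discriminant; the power [p ^ C] fixes it because it fixes the entries
   of [P] and permits no change in those of [M]. *)
set c := \det P * \det M in detE.
have c0 : c != 0 by rewrite mulf_neq0.
have rE : r = m.
  apply/eqP; rewrite eqn_leq rm leqNgt; apply/negP => lt.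
  move: (expf_neq0 2 c0); rewrite detE => /prodf_neq0/(_ (Ordinal lt) isT).
  by rewrite /std_weight /= ltnn rmorph0 eqxx.
have m0 : (0 < m)%N by case: (m) m_odd.
have wE (i : 'I_m) : v (std_weight r d0 i) = if i.+1 == m then c ^+ 2 else 1.
  have wE' (j : 'I_m) : v (std_weight r d0 j) = if j.+1 == m then d else 1.
    by rewrite /std_weight rE ltn_ord; case: ifP; rewrite ?rmorph1.
  rewrite wE' detE; case: ifP => // _.
  have lt : (m.-1 < m)%N by rewrite prednK.
  under eq_bigr do rewrite wE'.
  rewrite (bigD1 (Ordinal lt)) //= prednK // eqxx big1 ?mulr1 // => j ji.
  case: eqP => // jm; case/eqP: ji; apply/val_inj; exact: (congr1 predn jm).
have PC i j : P i j ^+ (p ^ C) = P i j by rewrite mxE; case/k0P: (vk0 (P0 i j)).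
have cC : c ^+ (p ^ C) = c.
  have [f fE] := frob_rmorphism C; rewrite -fE rmorphM /= -!det_map_mx.
  have -> : map_mx f P = P by apply/matrixP => i j; rewrite mxE fE PC.
  congr (_ * \det _); apply/matrixP => i j; rewrite mxE fE ME.
  by rewrite exprAC [X in X ^+ _]exprAC thC.
(* c^(p^n) = -c would give c^(p^(n m)) = -c, as m is odd. *)
have cn : c ^+ (p ^ n) = c.
  have : (c ^+ (p ^ n)) ^+ 2 = c ^+ 2.
    have lt : (m.-1 < m)%N by rewrite prednK.
    rewrite exprAC; have := wE (Ordinal lt); rewrite /= prednK // eqxx => <-.
    by case/k0P: (vk0 (std_weight r d0 m.-1)).
  move/eqP; rewrite eqf_sqr => /orP[/eqP // | /eqP cN].
  have sgn : (-1) ^+ (p ^ n) = -1 :> L by rewrite -signr_odd oddX p_odd orbT.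
  have : c ^+ (p ^ (n * m)) = (-1) ^+ m * c.
    elim: (m) => [|k IH]; first by rewrite muln0 expr1 mul1r.
    rewrite mulnS addnC expnD exprM IH exprMn cN exprAC.
    by rewrite sgn mulrN exprS mulN1r mulNr.
  rewrite mulnC -NE frob_dim -signr_odd m_odd expr1 mulN1r => /eqP.
  by rewrite -addr_eq0 -mulr2n -mulr_natl mulf_eq0 (negPf two0) (negPf c0).
(* Dividing the last vector by [c] turns its weight [c ^+ 2] into 1. *)
pose u (i : 'I_m) := if i.+1 == m then c^-1 else 1.
have un i k : u i ^+ (p ^ (n * k)) = u i.
  by rewrite /u; case: ifP; rewrite ?expr1n // exprVn frob_fix_mul.
have uC i : u i ^+ (p ^ C) = u i.
  by rewrite /u; case: ifP; rewrite ?expr1n // exprVn cC.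
have Pn i j k : P i j ^+ (p ^ (n * k)) = P i j.
  by rewrite frob_fix_mul // mxE; case/k0P: (vk0 (P0 i j)).
exists (fun i => u i * \sum_j P i j * theta ^+ j); split=> [i | i j].
  rewrite exprMn uC frob_sum; congr (_ * _); apply: eq_bigr => j _.
  by rewrite exprMn PC exprAC thC.
(* Up to the factor [u l], the conjugates of the vector form a row of [P *m M], so the Gram matrix
   is [P *m G *m P^T] rescaled by [u] on both sides. *)
have eE (l k : 'I_m) :
    (u l * \sum_j P l j * theta ^+ j) ^+ (p ^ (n * k)) = u l * (P *m M) l k.
  rewrite exprMn un frob_sum [(P *m M) _ _]mxE; congr (_ * _).
  by apply: eq_bigr => t _; rewrite exprMn Pn ME.
under eq_bigr do rewrite exprMn !eE mulrACA.
have := congr1 (fun A : 'M_m => A i j) dE.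
rewrite mulmxA -mulmxA -trmx_mul [LHS]mxE -mulr_sumr.
under eq_bigr do rewrite [(_^T)%R _ _]mxE.
move=> ->; rewrite [diag_mx _ _ _]mxE [(\row__ _) _ _]mxE wE.
case: (i =P j) => [<- | _]; last by rewrite mulr0.
rewrite mulr1n /u; case: ifP => _; last by rewrite !mulr1.
by rewrite -expr2 -exprMn mulVf ?expr1n.
Qed.

End FrobeniusPowers.

(** * The trace form of an extension *)

Lemma big_ord_divmod (R : Type) (idx : R) (op : Monoid.law idx) n m (E : nat -> R) :
  \big[op/idx]_(k < n * m) E k =
  \big[op/idx]_(i < n) \big[op/idx]_(j < m) E (i * m + j)%N.
Proof.
rewrite -[LHS](big_mkord xpredT) big_nat_mul big_mkord; apply: eq_bigr => i _.
rewrite -{1}[(i * m)%N]add0n big_addn mulSnr [(i * m + m)%N]addnC addnK big_mkord.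
by apply: eq_bigr => j _; rewrite addnC.
Qed.

Section Extension.

Variables (p n m : nat) (K L : splittingFieldType 'F_p).
Hypotheses (p_pr : prime p) (dimK : \dim {:K} = n) (dimL : \dim {:L} = (m * n)%N).
Variable iota : {rmorphism K -> L}.

(** Scalars of ['F_p] act as natural multiples, which any ring morphism respects. *)
Lemma Fp_morphZ (a : 'F_p) x : iota (a *: x) = a *: iota x.
Proof. by rewrite -[a]natr_Zp !scaler_nat rmorphMn. Qed.

Lemma morph_frob x k : iota x ^+ (p ^ (n * k)) = iota x.
Proof. by apply: frob_fix_mul => //; rewrite -rmorphXn -dimK frob_dim. Qed.

(** Transitivity of the trace: with exponents written [i * n + j], the sum over [i] is the relative
    trace and the sum over [j] the trace of [K]. *)
Lemma abs_trace_tower (z : L) y :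
    \sum_(k < m) z ^+ (p ^ (n * k)) = iota y -> abs_trace z = abs_trace y.
Proof.
move=> zy; apply: (@scalar1_inj p L).
have -> : (abs_trace y)%:A = iota (abs_trace y)%:A :> L by rewrite Fp_morphZ rmorph1.
rewrite !abs_traceE // rmorph_sum dimL dimK.
rewrite (big_ord_divmod _ m n (fun k => z ^+ (p ^ k))) exchange_big.
apply: eq_bigr => i _; rewrite /= rmorphXn /= -zy frob_sum //.
by apply: eq_bigr => j _; rewrite -exprM -expnD mulnC.
Qed.

Variables (e : 'I_m -> L) (C : nat).
Hypothesis eC : forall i, e i ^+ (p ^ C) = e i.
Hypothesis e_dual : forall i j,
  \sum_(k < m) (e i * e j) ^+ (p ^ (n * k)) = (i == j)%:R.

Lemma dual_trace (y : 'I_m -> 'I_m -> K) :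
  abs_trace (\sum_i \sum_j iota (y i j) * (e i * e j)) = abs_trace (\sum_i y i i).
Proof.
apply: abs_trace_tower; under eq_bigr do rewrite frob_sum //.
rewrite exchange_big rmorph_sum; apply: eq_bigr => i _ /=.
under eq_bigr do rewrite frob_sum //.
rewrite exchange_big (bigD1 i) //= [X in _ + X]big1 => [|j ji].
  under eq_bigr do rewrite exprMn morph_frob.
  by rewrite -mulr_sumr e_dual eqxx mulr1 addr0.
under eq_bigr do rewrite exprMn morph_frob.
by rewrite -mulr_sumr e_dual eq_sym (negPf ji) mulr0.
Qed.

(** Multiplying by [e i] and taking the relative trace recovers [x i]. *)
Lemma dual_coord_inj (x : 'I_m -> K) :
  \sum_j iota (x j) * e j = 0 -> forall i, x i = 0.
Proof.
move=> x0 i; apply: (fmorph_inj iota); rewrite rmorph0.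
transitivity (\sum_j iota (x j) * \sum_(k < m) (e i * e j) ^+ (p ^ (n * k))).
  rewrite (bigD1 i) //= [X in _ + X]big1 => [|j ji].
    by rewrite e_dual eqxx mulr1 addr0.
  by rewrite e_dual eq_sym (negPf ji) mulr0.
transitivity (\sum_(k < m) (e i * \sum_j iota (x j) * e j) ^+ (p ^ (n * k))).
  under [RHS]eq_bigr do rewrite mulr_sumr frob_sum //.
  rewrite exchange_big; apply: eq_bigr => j _; rewrite mulr_sumr.
  by apply: eq_bigr => k _; rewrite [in RHS]mulrCA [in RHS]exprMn morph_frob.
by rewrite big1 // => k _; rewrite x0 mulr0 expr0n eqn0Ngt expn_gt0 prime_gt0.
Qed.

Variables (k : nat) (a : nat -> K) (alpha : nat -> nat).
Hypothesis C_alpha : forall i, (1 <= i <= k)%N -> (C %| alpha i)%N.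
Let f : {poly K} := \sum_(1 <= i < k.+1) a i *: 'X^(p ^ alpha i + 1).

(** As [C] divides [alpha i], the power [p ^ alpha i] fixes every [e j], and each monomial expands
    bilinearly in the [e j]. *)
Lemma horner_dual (x : 'I_m -> K) :
  (map_poly iota f).[\sum_j iota (x j) * e j] =
  \sum_j \sum_l iota (\sum_(1 <= i < k.+1) a i * (x j ^+ (p ^ alpha i) * x l))
    * (e j * e l).
Proof.
rewrite rmorph_sum horner_sum.
have -> (g : nat -> 'I_m -> 'I_m -> K) :
    \sum_j \sum_l iota (\sum_(1 <= i < k.+1) g i j l) * (e j * e l) =
    \sum_(1 <= i < k.+1) \sum_j \sum_l iota (g i j l) * (e j * e l).
  rewrite [RHS]exchange_big; apply: eq_bigr => j _; rewrite [RHS]exchange_big.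
  by apply: eq_bigr => l _; rewrite rmorph_sum mulr_suml.
apply: eq_big_nat => i ik; rewrite /= map_polyZ /= map_polyXn hornerZ hornerXn.
rewrite exprD expr1 frob_sum // mulr_suml mulr_sumr; apply: eq_bigr => j _.
rewrite !mulr_sumr; apply: eq_bigr => l _.
have -> : (iota (x j) * e j) ^+ (p ^ alpha i) = iota (x j ^+ (p ^ alpha i)) * e j.
  have /dvdnP[q ->] := C_alpha ik.
  by rewrite exprMn rmorphXn mulnC (frob_fix_mul _ (eC j)).
by rewrite !rmorphM /=; ring.
Qed.

Lemma trace_form_dual (x : 'I_m -> K) :
  trace_form (map_poly iota f) (\sum_j iota (x j) * e j) = \sum_j trace_form f (x j).
Proof.
rewrite /trace_form horner_dual dual_trace.
have -> : \sum_j abs_trace f.[x j] = abs_trace (\sum_j f.[x j]).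
  elim/big_rec2: _ => [|j u v _ ->]; last by rewrite abs_traceD.
  by rewrite -(scale0r (0 : K)) abs_traceZ // mul0r.
congr abs_trace; apply: eq_bigr => j _; rewrite horner_sum.
by apply: eq_bigr => i _; rewrite hornerZ hornerXn exprD expr1.
Qed.

(** Splitting [x ^+ (p ^ alpha i + 1)] into its two factors gives a bilinear form, in general not
    symmetric. *)
Lemma trace_form_diagonalized : odd p ->
  exists r d, [/\ (r <= \dim {:K})%N, d != 0 & diagonalized (trace_form f) r d].
Proof.
move=> p_odd; have two0 := pchar_odd_two_neq0 (pchar_Fp p_pr) p_odd.
pose B (x y : K) := abs_trace (\sum_(1 <= i < k.+1) a i * (x ^+ (p ^ alpha i) * y)).
apply: (bilinear_diagonalized two0 (B := B)) => [c x x' y | c x y y' | v].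
- rewrite -abs_traceZ // -abs_traceD // scaler_sumr -big_split.
  congr abs_trace; apply: eq_bigr => i _; rewrite frobD // frobZ // mulrDl mulrDr.
  by rewrite scalerAr scalerAl.
- rewrite -abs_traceZ // -abs_traceD // scaler_sumr -big_split.
  congr abs_trace; apply: eq_bigr => i _; rewrite !mulrDr.
  by rewrite !scalerAr.
rewrite /trace_form horner_sum; congr abs_trace; apply: eq_bigr => i _.
by rewrite hornerZ hornerXn exprD expr1.
Qed.

(** The product of [iota b_i] and [e j] gets index [i * m + j]: each weight is repeated [m] times in
    a row, so nonzero weights stay in front. *)
Lemma trace_form_dual_diag (b : (\dim {:K}).-tuple K) w :
    basis_of {:K} b -> diag_in b w (trace_form f) ->
  exists2 b' : (\dim {:L}).-tuple L, basis_of {:L} b' &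
    diag_in b' (fun q => w (q %/ m)%N) (trace_form (map_poly iota f)).
Proof.
(* [e'], and [ext] below, extend families on ordinals by 0 to [nat], to allow index arithmetic. *)
move=> bb bw; pose e' q := oapp e 0 (insub q).
have e'E (j : 'I_m) : e' j = e j by rewrite /e' valK.
pose b' := [tuple iota b`_(q %/ m) * e' (q %% m)%N | q < \dim {:L}].
have b'E (q : 'I_(\dim {:L})) : b'`_q = iota b`_(q %/ m) * e' (q %% m)%N.
  by rewrite -tnth_nth tnth_mktuple.
have divE i (j : 'I_m) : ((i * m + j) %/ m = i)%N.
  by rewrite divnMDl ?divn_small ?addn0 // (leq_ltn_trans _ (ltn_ord j)).
have modE i (j : 'I_m) : ((i * m + j) %% m = j)%N by rewrite modnMDl modn_small.
have dimLE : \dim {:L} = (\dim {:K} * m)%N by rewrite dimL dimK mulnC.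
pose ext (c : 'I_(\dim {:L}) -> 'F_p) q := oapp c 0 (insub q).
have extE c (q : 'I_(\dim {:L})) : ext c q = c q by rewrite /ext valK.
pose x c (j : 'I_m) := \sum_(i < \dim {:K}) ext c (i * m + j)%N *: b`_i.
have comb (c : 'I_(\dim {:L}) -> 'F_p) :
    \sum_(q < \dim {:L}) c q *: b'`_q = \sum_j iota (x c j) * e j.
  pose E q := ext c q *: (iota b`_(q %/ m) * e' (q %% m)%N).
  transitivity (\sum_(q < \dim {:L}) E q).
    by apply: eq_bigr => q _; rewrite b'E /E extE.
  rewrite dimLE big_ord_divmod exchange_big; apply: eq_bigr => j _ /=.
  rewrite rmorph_sum mulr_suml; apply: eq_bigr => i _.
  by rewrite /E divE modE e'E Fp_morphZ scalerAl.
have b'f : free b'.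
  apply/freeP => c; rewrite comb => c0 q; have x0 := dual_coord_inj c0.
  have m0 : (0 < m)%N by have := adim_gt0 {:L}%AS; rewrite dimLE muln_gt0 => /andP[].
  have qm : (q %/ m < \dim {:K})%N by rewrite ltn_divLR // -dimLE.
  have /freeP/(_ (fun i => ext c (i * m + q %% m)%N)) fb := basis_free bb.
  have := fb (x0 (Ordinal (ltn_pmod q m0))) (Ordinal qm).
  by rewrite /= -divn_eq extE.
have bb' : basis_of {:L} b' by rewrite basisEfree b'f subvf size_tuple leqnn.
exists b' => // v; pose c q := coord b' q v.
rewrite {1}(coord_basis bb' (memvf v)) (comb c) trace_form_dual.
under eq_bigr do rewrite bw.
transitivity (\sum_(q < \dim {:L}) w (q %/ m)%N * ext c q ^+ 2); last first.
  by apply: eq_bigr => q _; rewrite extE.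
rewrite dimLE (big_ord_divmod _ _ _ (fun q => w (q %/ m)%N * ext c q ^+ 2)).
rewrite exchange_big; apply: eq_bigr => i _; apply: eq_bigr => j _ /=.
by rewrite divE coord_sum_free ?(basis_free bb).
Qed.

End Extension.

(** * From p-adic orders to nullity and type *)

Lemma padic_order_le p C m : prime p ->
  ((C%:Z)%:E <= padic_order p m)%E -> (p ^ C %| m)%N.
Proof.
move=> p_pr; rewrite /padic_order; case: posnP => [-> //|m0].
by rewrite lee_fin lez_nat pfactor_dvdn.
Qed.

Theorem corollary6p3
  (p n k s : nat) (hp : prime p) (hp_odd : odd p)
  (hn : (1 <= n)%N) (hk : (1 <= k)%N)
  (K : splittingFieldType 'F_p) (hK : \dim {:K} = n)
  (L : splittingFieldType 'F_p) (hL : \dim {:L} = (p ^ s * n)%N)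
  (iota : {rmorphism K -> L})
  (a : nat -> K) (alpha : nat -> nat)
  (halpha : forall i j : nat,
     (1 <= i)%N -> (i < j)%N -> (j <= k)%N -> (alpha i < alpha j)%N)
  (ha : a k != 0)
  (f : {poly K})
  (hf : f = \sum_(1 <= i < k.+1) a i *: 'X^(p ^ alpha i + 1))
  (hnu : (padic_order p n
            < \big[Order.min/+oo]_(1 <= i < k.+1) padic_order p (alpha i))%E)
  (hs : ((s%:Z)%:E
           <= \big[Order.min/+oo]_(1 <= i < k.+1) padic_order p (alpha i)
              - padic_order p n)%E) :
  l_ (map_poly iota f) = (p ^ s * l_ f)%N /\ t_ (map_poly iota f) = t_ f.
Proof.
(* [s + logn p n] is the order of [m * n], and by [hs] it is at most the order of every
   [alpha i]. *)
subst f; set m := (p ^ s)%N in hL *; pose C := (p ^ (s + logn p n))%N.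
have C_alpha i : (1 <= i <= k)%N -> (C %| alpha i)%N.
  move=> ik; apply: padic_order_le => //; move: hs.
  rewrite {2}/padic_order gtn_eqF // leeBrDr // -EFinD => /le_trans; apply.
  by rewrite ge_bigmin_seq ?mem_index_iota.
have C0 : (0 < C)%N by rewrite expn_gt0 prime_gt0.
have m0 : (0 < m)%N by rewrite expn_gt0 prime_gt0.
have m_odd : odd m by rewrite oddX hp_odd orbT.
have CL : (C %| \dim {:L})%N.
  by rewrite hL /C expnD dvdn_pmul2l // pfactor_dvdn.
(* [0 < j < p ^ s] forces the order of [j] below [s], hence that of [n * j] below [s + logn p n]. *)
have Cj j : (0 < j < m)%N -> ~~ (C %| n * j)%N.
  case/andP=> j0; apply: contraL; rewrite pfactor_dvdn ?muln_gt0 ?hn // lognM //.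
  by rewrite addnC leq_add2l -pfactor_dvdn // -leqNgt; apply: dvdn_leq.
have [e [eC e_dual]] := self_dual_system hp hp_odd hL m_odd C0 CL Cj.
have two0 := pchar_odd_two_neq0 (pchar_Fp hp) hp_odd.
have [r [d [rn d0 /diagonalizedP[b bb bf]]]] :=
  trace_form_diagonalized hp k a alpha hp_odd.
have [b' bb' bf'] := trace_form_dual_diag hp hK hL iota eC e_dual C_alpha bb bf.
have w0 i : (i < \dim {:K})%N -> (std_weight r d i != 0) = (i < r)%N.
  by move=> _; apply: std_weight_neq0.
have w0' q : (q < \dim {:L})%N -> (std_weight r d (q %/ m)%N != 0) = (q < r * m)%N.
  by move=> _; rewrite std_weight_neq0 // ltn_divLR.
have rm : (r * m <= \dim {:L})%N by rewrite hL -hK mulnC leq_mul2l rn orbT.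
have [rK tK] := diag_in_invariants two0 bb bf rn w0.
have [rL tL] := diag_in_invariants two0 bb' bf' rm w0'.
rewrite /l_ /t_ /nullity rK tK rL tL hL hK mulnBr [(r * m)%N]mulnC; split=> //.
(* Grouping the weights in runs of [m] gives the [m]-th power of the discriminant. *)
rewrite mulnC (big_ord_divmod _ r m (fun q => std_weight r d (q %/ m)%N)).
rewrite -[RHS](quad_charX _ m_odd); last first.
  by apply/prodf_neq0 => i _; rewrite std_weight_neq0.
congr quad_char; rewrite -prodrXl; apply: eq_bigr => i _.
rewrite -[m in RHS]card_ord -prodr_const; apply: eq_bigr => j _.
by rewrite divnMDl // divn_small ?addn0.
Qed.
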